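(* Let $\{f_i\}_{i=1}^\infty$ be a frame for the separable Hilbert space $\mathcal H$ with pre-frame operator $T : l^2(\mathbf N)\to\mathcal H$, $T\{c_i\}=\sum_{i=1}^\infty c_i f_i$, and let $U : l^2(\mathbf N)\to l^2(\mathbf N)$ be a bounded operator with transpose $U^T$. Then $$\dim (N_{TU^{T}})= \dim (R_{U^T} \cap N_T) + \dim(R_U^{\perp}).$$
   Context: A family $\{f_i\}_{i=1}^\infty$ in a separable Hilbert space $\mathcal H$ is a frame for $\mathcal H$ if there are $A,B>0$ with $A\|f\|^2\le\sum_i|\langle f,f_i\rangle|^2\le B\|f\|^2$ for all $f\in\mathcal H$. Its pre-frame operator $T$ is then well defined and bounded. Let $\{u_{i,j}\}_{i,j\in\mathbf N}$ be the matrix of $U$ with respect to the canonical orthonormal basis of $l^2(\mathbf N)$, so $(U\{c_j\})_i=\sum_j u_{i,j}c_j$. The transpose $U^T$ is the bounded operator on $l^2(\mathbf N)$ whose matrix is the transpose $\{u_{j,i}\}_{i,j\in\mathbf N}$ (no complex conjugation). For a linear operator $V$, $N_V$ denotes its kernel and $R_V$ its range; $R_U^\perp$ is the orthogonal complement of $R_U$ in $l^2(\mathbf N)$. Dimensions are vector space dimensions and may be infinite. (The operator $TU^T$ is the operator $\{c_i\}\mapsto\sum_i c_i g_i$ associated with the family $g_i=\sum_{j=1}^\infty u_{i,j}f_j$.) *)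

(* Defs.v *)
From HB Require Import structures.
From mathcomp Require Import all_boot all_order all_algebra.
From mathcomp Require Import complex.
From mathcomp Require Import all_classical all_reals all_analysis.
From mathcomp Require Import lra.

Set Implicit Arguments.
Unset Strict Implicit.
Unset Printing Implicit Defensive.
Import Order.TTheory GRing.Theory Num.Theory.
Import numFieldNormedType.Exports.
Local Open Scope classical_set_scope.
Local Open Scope card_scope.
Local Open Scope ring_scope.

(* Hilbert spaces are taken over the real or over the complex numbers; the
   base field is [scalar_field R k], with [k] telling which of the two it is. *)
Variant scalar_kind := RealScalars | ComplexScalars.

Definition scalar_field (R : realType) (k : scalar_kind) : numFieldType :=
  match k with RealScalars => R | ComplexScalars => R[i] end.

Definition sconj (R : realType) (k : scalar_kind) :
    scalar_field R k -> scalar_field R k :=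
  match k with RealScalars => fun z => z | ComplexScalars => fun z => conjc z end.

(* The norm of a [numFieldType] takes its values in the field itself, hence in
   [R[i]] when the scalars are complex; [smod] is the same number seen in [R]. *)
Definition smod (R : realType) (k : scalar_kind) : scalar_field R k -> R :=
  match k with
  | RealScalars => fun z => `|z|
  | ComplexScalars => fun z => Normc.normc z
  end.

Section Smod.
Context {R : realType} {k : scalar_kind}.
Implicit Types x y : scalar_field R k.

Lemma smod_ge0 x : 0 <= smod x.
Proof.
case: k x => x /=; first exact: normr_ge0.
by case: x => a b; exact: sqrtr_ge0.
Qed.

Lemma smod0 : smod (0 : scalar_field R k) = 0.
Proof. by case: k => /=; [exact: normr0|exact: Normc.normc0]. Qed.

Lemma smodM x y : smod (x * y) = smod x * smod y.
Proof. by case: k x y => x y /=; [exact: normrM|exact: Normc.normcM]. Qed.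

Lemma smodD x y : smod (x + y) <= smod x + smod y.
Proof. by case: k x y => x y /=; [exact: ler_normD|exact: le_normcD]. Qed.

End Smod.

(* The sum is [+oo] when the series diverges. *)
Definition sqsum (R : realType) (k : scalar_kind) (x : nat -> scalar_field R k) :
    \bar R := (\sum_(0 <= i <oo) (smod (x i) ^+ 2)%:E)%E.

Section L2.
Variables (R : realType) (k : scalar_kind).
Local Notation K := (scalar_field R k).

Definition l2_pred : {pred nat -> K^o} :=
  [pred x : nat -> K^o | `[< (sqsum x < +oo)%E >]].

Fact l2_submod_closed : submod_closed l2_pred.
Proof.
split.
  apply/asboolP; rewrite /sqsum eseries0 ?ltry// => i _ _.
  by rewrite /= smod0 expr0n.
move=> a x y /asboolP x2 /asboolP y2; apply/asboolP.
have ge0 (z : nat -> K) i : (0 <= (smod (z i) ^+ 2)%:E)%E.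
  by rewrite lee_fin exprn_ge0// smod_ge0.
pose c : R := 2 * smod a ^+ 2.
have c0 : 0 <= c by rewrite mulr_ge0// exprn_ge0// smod_ge0.
have le_terms i : ((smod ((a *: x + y) i) ^+ 2)%:E <=
    c%:E * (smod (x i) ^+ 2)%:E + 2%:E * (smod (y i) ^+ 2)%:E)%E.
  rewrite -!EFinM -EFinD lee_fin.
  have -> : (a *: x + y) i = a * x i + y i by [].
  have h := smodD (a * x i) (y i); rewrite smodM in h.
  have := mulr_ge0 (smod_ge0 a) (smod_ge0 (x i)); have := smod_ge0 (y i).
  rewrite /c -mulrA -exprMn; move: h.
  move: (smod a * smod (x i)) (smod (y i)) => p q h q0 p0.
  apply: (@le_trans _ _ ((p + q) ^+ 2)).
    by rewrite lerXn2r// nnegrE ?smod_ge0// addr_ge0.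
  by have := sqr_ge0 (p - q); rewrite !expr2; nra.
apply: le_lt_trans.
  by apply: lee_nneseries => [i _ _|i _]; [exact: ge0|exact: le_terms].
rewrite nneseriesD; last 2 first.
- by move=> i _ _; rewrite mule_ge0// lee_fin.
- by move=> i _ _; rewrite mule_ge0// lee_fin.
rewrite !nneseriesZl//.
by rewrite lte_add_pinfty// lte_mul_pinfty// lee_fin.
Qed.

HB.instance Definition _ :=
  GRing.isSubmodClosed.Build K (nat -> K^o) l2_pred l2_submod_closed.

Record l2 := L2 { l2seq :> nat -> K^o ; l2seqP : l2seq \in l2_pred }.

HB.instance Definition _ := [isSub for l2seq].
HB.instance Definition _ := [Choice of l2 by <:].
HB.instance Definition _ := [SubChoice_isSubLmodule of l2 by <:].

Definition l2norm (x : l2) : R := Num.sqrt (fine (sqsum x)).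

Definition l2dot (x y : l2) : K :=
  limn (series (fun i => (x i : K) * sconj (y i))).

Fact l2_delta_subproof (j : nat) :
  (fun i => (i == j)%:R : K^o) \in l2_pred.
Proof.
apply/asboolP; rewrite /sqsum (@nneseriesD1 _ _ j)//=; last first.
  by move=> i _; rewrite lee_fin exprn_ge0// smod_ge0.
rewrite eseries0 ?adde0 ?ltry// => i _ /negbTE /= ->.
by rewrite smod0 expr0n.
Qed.

Definition l2_delta (j : nat) : l2 := L2 (l2_delta_subproof j).

Definition l2_bounded (U : l2 -> l2) : Prop :=
  exists M : R, forall x : l2, l2norm (U x) <= M * l2norm x.

(* The entry [u_{i,j}] of the matrix of [U]: column [j] is [U e_j]. *)
Definition l2_matrix (U : l2 -> l2) (i j : nat) : K := U (l2_delta j) i.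

Definition l2_orthogonal (A : set l2) : set l2 :=
  [set y | forall x, A x -> l2dot x y = 0].

End L2.

Section Dimension.
Variables (K : fieldType) (V : lmodType K).

Definition lin_indep (B : set V) : Prop :=
  forall (s : seq V) (a : V -> K), uniq s -> [set` s] `<=` B ->
    \sum_(v <- s) a v *: v = 0 -> forall v, v \in s -> a v = 0.

Definition lin_span (B : set V) : set V :=
  [set v | exists (s : seq V) (a : V -> K),
     [set` s] `<=` B /\ v = \sum_(u <- s) a u *: u].

Definition hamel_basis (W B : set V) : Prop :=
  lin_indep B /\ lin_span B = W.

(* [dim W = dim W1 + dim W2] for subspaces of [V], as an equality of possibly
   infinite cardinals: the dimension of a subspace is the cardinal of any of
   its Hamel bases.  The union on the right is a disjoint one because [B1] and
   [B2] may overlap in [V]. *)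
Definition dim_eq_add (W W1 W2 : set V) : Prop :=
  forall B B1 B2 : set V,
    hamel_basis W B -> hamel_basis W1 B1 -> hamel_basis W2 B2 ->
    B #= ([set inl b | b in B1] `|` [set inr b | b in B2] : set (V + V)).

End Dimension.

Definition ker (V W : zmodType) (g : V -> W) : set V := g @^-1` [set 0].

Section Frames.
Variables (R : realType) (k : scalar_kind).
Local Notation K := (scalar_field R k).
Variable H : completeNormedModType K.

Definition separable : Prop := exists2 D : set H, countable D & dense D.

Definition is_frame (ip : {dot H for @sconj R k}) (f : nat -> H) : Prop :=
  exists A B : R, [/\ 0 < A, 0 < B &
    forall g : H,
      (A%:E * (smod `|g| ^+ 2)%:E <= sqsum (fun i => ip g (f i)))%E /\
      (sqsum (fun i => ip g (f i)) <= B%:E * (smod `|g| ^+ 2)%:E)%E].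

(* Total by [limn]; the series converges for every [c] when [f] is a frame. *)
Definition preframe (f : nat -> H) (c : l2 R k) : H :=
  limn (series (fun i => (c i : K) *: f i)).

End Frames.

(* Main.v *)
From HB Require Import structures.
Require Import Defs.
From mathcomp Require Import all_boot all_order all_algebra.
From mathcomp Require Import complex.
From mathcomp Require Import all_classical all_reals all_analysis.
From mathcomp Require Import ring.
Set Implicit Arguments.
Unset Strict Implicit.
Unset Printing Implicit Defensive.
Import Order.TTheory GRing.Theory Num.Theory.
Import numFieldNormedType.Exports.
Local Open Scope classical_set_scope.
Local Open Scope ring_scope.

(** The set [ker (preframe f \o UT)] is the preimage [UT @^-1` N] of
    [N = ker (preframe f)], and the restriction of [UT] to it is a linear map
    onto [range UT `&` N] with kernel [ker UT].  Rank-nullity therefore gives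
    dim (UT^-1 N) = dim (range UT `&` N) + dim (ker UT), and what remains is to
    compare [ker UT] with the orthogonal complement of [range U].

    Rank-nullity for Hamel bases, [dim_eq_add_preimage].  A basis of the
    image, lifted, together with a basis of the kernel is a basis of the
    preimage ([hamel_basis_lift]).  As the equality is one of cardinals and the
    bases are arbitrary, one also needs two bases of the same, possibly
    infinite-dimensional, subspace to be equipotent ([hamel_basis_card]).  This
    is a Steinitz exchange run by Zorn's lemma ([lin_indep_card_le]): an
    independent set [A] in the span of [B] injects into [B], because a maximal
    way of exchanging elements of [A] for elements of [B] without losing
    independence must exchange all of [A].  No cardinal arithmetic enters, and
    finite and infinite dimensions are treated alike.  That the preimage is a
    subspace follows from its having a basis.

    Duality, [l2_conj_orthogonal_range].  The transpose carries no complex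
    conjugation whereas the inner product does, so it is the conjugate of a
    vector orthogonal to [range U] that lies in [ker UT].  Conjugation is
    semilinear and bijective, hence carries bases to bases
    ([hamel_basis_semilinear]), and the dimensions agree.  That conjugation
    matches the two sets rests on bounded operators being given by their
    matrices, [(U x) i = \sum_j u_ij x_j] ([l2_matrix_cvg]), and on the
    Cauchy-Schwarz inequality ([smod_pairing_le]), which allows passing to
    finitely supported vectors. *)

(** * Hamel bases and the invariance of dimension *)

Section LinearSpan.
Variables (K : fieldType) (V : lmodType K).
Implicit Types (A B S W : set V) (s : seq V) (u v : V).

(** Lists of scalar-vector pairs may repeat a vector with different scalars, so
    they can be concatenated; a coefficient function on a list cannot express
    that.  Collecting the scalars attached to each vector passes from the first
    form to the second, moreover without repetition, which is the form that
    [lin_indep] speaks about. *)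
Lemma lin_span_pairs B (l : seq (K * V)) : (forall p, p \in l -> B p.2) ->
  exists s (a : V -> K), [/\ uniq s, [set` s] `<=` B &
    \sum_(p <- l) p.1 *: p.2 = \sum_(u <- s) a u *: u].
Proof.
move=> lB; exists (undup (map snd l)), (fun u => \sum_(p <- l | p.2 == u) p.1).
split; first exact: undup_uniq.
  by move=> u /=; rewrite mem_undup => /mapP[p pl ->]; exact: lB.
under [RHS]eq_bigr do rewrite scaler_suml big_mkcond/=.
rewrite exchange_big/= big_seq [RHS]big_seq; apply: eq_bigr => p pl.
have pu : p.2 \in undup (map snd l) by rewrite mem_undup map_f.
rewrite (bigD1_seq _ pu (undup_uniq _))/= eqxx big1 ?addr0// => u up.
by rewrite eq_sym (negbTE up).
Qed.

Lemma lin_spanP B v : lin_span B v <->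
  exists2 l : seq (K * V), (forall p, p \in l -> B p.2) &
    v = \sum_(p <- l) p.1 *: p.2.
Proof.
split=> [[s [a [sB ->]]]|[l lB ->]].
  exists [seq (a u, u) | u <- s]; last by rewrite big_map.
  by move=> p /mapP[u us ->]; exact: sB.
by have [s [a [_ sB ->]]] := lin_span_pairs lB; exists s, a.
Qed.

Lemma lin_span_uniq B v : lin_span B v ->
  exists s (a : V -> K),
    [/\ uniq s, [set` s] `<=` B & v = \sum_(u <- s) a u *: u].
Proof. by move=> /lin_spanP[l lB ->]; exact: lin_span_pairs. Qed.

Lemma lin_span0 B : lin_span B 0.
Proof. by exists [::], (fun=> 0); split=> //; rewrite big_nil. Qed.

Lemma lin_span_mem B v : B v -> lin_span B v.
Proof.
move=> Bv; exists [:: v], (fun=> 1); rewrite big_seq1 scale1r; split=> // u /=.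
by rewrite inE => /eqP ->.
Qed.

Lemma lin_spanD B u v : lin_span B u -> lin_span B v -> lin_span B (u + v).
Proof.
move=> /lin_spanP[l lB ->] /lin_spanP[m mB ->]; apply/lin_spanP.
exists (l ++ m); last by rewrite big_cat.
by move=> p; rewrite mem_cat => /orP[/lB|/mB].
Qed.

Lemma lin_spanZ B c v : lin_span B v -> lin_span B (c *: v).
Proof.
move=> [s [a [sB ->]]]; exists s, (fun u => c * a u); split=> //.
by rewrite scaler_sumr; apply: eq_bigr => u _; rewrite scalerA.
Qed.

Lemma lin_span_sum B (I : eqType) (r : seq I) (a : I -> K) (h : I -> V) :
  (forall i, i \in r -> lin_span B (h i)) ->
  lin_span B (\sum_(i <- r) a i *: h i).
Proof.
move=> hB; rewrite big_seq; apply: big_ind => //; first exact: lin_span0.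
  exact: lin_spanD.
by move=> i ir; exact/lin_spanZ/hB.
Qed.

Lemma lin_span_trans A B : A `<=` lin_span B -> lin_span A `<=` lin_span B.
Proof. by move=> AB v [s [a [sA ->]]]; apply: lin_span_sum => u /sA/AB. Qed.

Lemma lin_indep_sub A B : A `<=` B -> lin_indep B -> lin_indep A.
Proof. by move=> AB iB s a us sA; apply: iB => // u /sA/AB. Qed.

Lemma lin_indep_notin_span S v : lin_indep S -> S v ->
  ~ lin_span (S `\ v) v.
Proof.
move=> iS Sv /lin_span_uniq[s [a [us sS vE]]].
have vs : v \notin s by apply/negP => /sS[_]; exact.
suff /eqP : (if v == v then -1 else a v) = 0.
  by rewrite eqxx oppr_eq0 oner_eq0.
apply: (iS (v :: s) (fun u => if u == v then -1 else a u)).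
- by rewrite /= vs.
- by move=> u /=; rewrite inE => /orP[/eqP ->//|/sS[]].
- rewrite big_cons eqxx scaleN1r {1}vE addrC big_seq [X in _ - X]big_seq -sumrB.
  rewrite big1// => u us'; case: eqVneq => [uv|_]; last by rewrite subrr.
  by rewrite -uv us' in vs.
- exact: mem_head.
Qed.

Lemma lin_indepU1 S v : lin_indep S -> ~ lin_span S v -> lin_indep (v |` S).
Proof.
move=> iS Sv s a us sS sum0.
have rS : [set` rem v s] `<=` S.
  by move=> u /=; rewrite mem_rem_uniq// inE => /andP[/eqP uv /sS[]].
have [vs|vs] := boolP (v \in s); last first.
  apply: (iS _ _ us) => // u us'; have [uv|//] := sS _ us'.
  by rewrite -uv us' in vs.
rewrite (perm_big _ (perm_to_rem vs)) big_cons /= in sum0.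
have av0 : a v = 0.
  apply: contrapT => /eqP av0; apply: Sv.
  suff -> : v = - (a v)^-1 *: \sum_(u <- rem v s) a u *: u.
    by apply/lin_spanZ/lin_span_sum => u /rS/lin_span_mem.
  move/eqP: sum0; rewrite addrC addr_eq0 => /eqP ->.
  by rewrite scalerN scaleNr opprK scalerA mulVf// scale1r.
move: sum0; rewrite av0 scale0r add0r => sum0 u us'.
have [->//|uv] := eqVneq u v.
by apply: (iS _ _ (rem_uniq v us) rS sum0); rewrite mem_rem_uniq// inE uv.
Qed.

Lemma lin_indep_neq0 S v : lin_indep S -> S v -> v != 0.
Proof.
move=> iS Sv; apply/eqP => v0; apply: (lin_indep_notin_span iS Sv).
by rewrite {2}v0; exact: lin_span0.
Qed.

(** A graph [G] of pairs [(a, b)] records that each such [a] in [A] has been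
    replaced by [b]; this is the set that results. *)
Definition exchange (A : set V) (G : set (V * V)) : set V :=
  (A `\` fst @` G) `|` snd @` G.

(** The objects ordered by Zorn's lemma: graphs of partial injections from [A]
    to [B] whose exchange is independent.  The second clause says at once that
    [G] is functional and injective.  The third prevents an element of [A] that
    is still to be replaced from having already been brought in as an element
    of [B]: it would then occur once in the exchanged set but twice in the
    exchanged family. *)
Definition exchange_graph A B (G : set (V * V)) : Prop :=
  [/\ G `<=` A `*` B,
      (forall p q, G p -> G q -> (p.1 == q.1) = (p.2 == q.2)),
      (A `\` fst @` G) `&` snd @` G = set0 &
      lin_indep (exchange A G)].

(** Independence is tested on finite lists.  A finite list of the set exchanged
    along the union of a chain uses finitely many of the vectors brought in,
    and those are already brought in by one member of the chain. *)
Lemma exchange_graph_bigcup A B (F : set (set (V * V))) : lin_indep A ->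
  F `<=` exchange_graph A B -> total_on F subset ->
  exchange_graph A B (\bigcup_(G in F) G).
Proof.
move=> iA FP Ftot; split.
- by move=> p [G /FP[+ _ _ _] Gp]; exact.
- move=> p q [G FG Gp] [G' FG' G'q].
  have [GG'|G'G] := Ftot _ _ FG FG'.
    by have [_ + _ _] := FP _ FG'; apply=> //; exact: GG'.
  by have [_ + _ _] := FP _ FG; apply=> //; exact: G'G.
- rewrite -subset0 => v [[Av ndom] [p [G FG Gp] pv]].
  have [_ _ + _] := FP _ FG; rewrite -subset0 => /(_ v); apply; split.
    by split=> // -[q Gq qv]; apply: ndom; exists q => //; exists G.
  by exists p.
have [F0|/set0P[G0 FG0]] := eqVneq F set0.
  suff -> : exchange A (\bigcup_(G in F) G) = A by [].
  by rewrite F0 bigcup_set0 /exchange !image_set0 setD0 setU0.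
move=> s a us sF.
(* Only the vectors brought in need attention: an element of [A] outside the
   domain of the union is outside the domain of every member. *)
have [G FG sG] : exists2 G, F G & forall u, u \in s ->
    (snd @` \bigcup_(X in F) X) u -> (snd @` G) u.
  elim: s {us sF} => [|u s [G FG sG]]; first by exists G0.
  have [[p [G' FG' G'p] pu]|nu] := pselect ((snd @` \bigcup_(X in F) X) u).
    have [GG'|G'G] := Ftot _ _ FG FG'.
      exists G' => // v; rewrite inE => /orP[/eqP -> _|vs /(sG _ vs)].
        by exists p.
      exact: image_subset.
    exists G => // v; rewrite inE => /orP[/eqP -> _|vs /(sG _ vs)//].
    by exists p => //; exact: G'G.
  by exists G => // v; rewrite inE => /orP[/eqP -> /nu//|vs /(sG _ vs)].
have [_ _ _ +] := FP _ FG; apply => // v vs.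
have [[Av ndom]|ran] := sF _ vs; last by right; exact: sG.
by left; split=> // -[q Gq qv]; apply: ndom; exists q => //; exists G.
Qed.

(** By independence, removing [a] leaves a set whose span misses [a].  As [B]
    spans [a], some [b] in [B] also lies outside that span, and it can take the
    place of [a]. *)
Lemma exchange_graph_extend A B G a : A `<=` lin_span B ->
  exchange_graph A B G -> A a -> ~ (fst @` G) a ->
  exists b, exchange_graph A B ((a, b) |` G).
Proof.
move=> AB [GAB inj disj ind] Aa adom.
pose S := exchange A G `\ a.
have Sa : ~ lin_span S a by apply: lin_indep_notin_span => //; left.
have [b Bb Sb] : exists2 b, B b & ~ lin_span S b.
  apply: contrapT => /forall2NP BS; apply: Sa.
  apply: (lin_span_trans _ (AB _ Aa)).
  by move=> b Bb; have [//|/contrapT] := BS b.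
have aran : ~ (snd @` G) a.
  by move=> aran; rewrite -subset0 in disj; exact: (disj a).
have ranS : snd @` G `<=` S.
  by move=> v Gv; split; [right|move=> va; rewrite -va in aran].
have bran : ~ (snd @` G) b by move=> /ranS/lin_span_mem.
exists b; split.
- by move=> p [->|/GAB].
- move=> p q [->|Gp] [->|Gq] /=; rewrite ?eqxx//; last exact: inj.
    apply/eqP/eqP => [aq|bq]; first by case: adom; exists q.
    by case: bran; exists q.
  apply/eqP/eqP => [pa|pb]; first by case: adom; exists p.
  by case: bran; exists p.
- rewrite -subset0 => v [[Av ndom] [p [->/= bv|Gp pv]]].
    apply: Sb; rewrite bv; apply: lin_span_mem; split.
      by left; split=> // -[q Gq qv]; apply: ndom; exists q => //; right.
    by move=> va; apply: ndom; exists (a, b) => //; left.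
  have [] : (set0 : set V) v; rewrite -disj; split; last by exists p.
  by split=> // -[q Gq qv]; apply: ndom; exists q => //; right.
- apply: (lin_indep_sub _ (lin_indepU1 (lin_indep_sub _ ind) Sb)); last first.
    by move=> v [].
  move=> v [[Av ndom]|[p [->/= <-|Gp pv]]]; [right|by left|right].
    split; last by move=> va; apply: ndom; exists (a, b) => //; left.
    by left; split=> // -[q Gq qv]; apply: ndom; exists q => //; right.
  by apply: ranS; exists p.
Qed.

(** A maximal exchange graph has domain all of [A], by [exchange_graph_extend],
    and so is the graph of an injection from [A] to [B]. *)
Lemma lin_indep_card_le A B :
  lin_indep A -> A `<=` lin_span B -> (A #<= B)%card.
Proof.
move=> iA AB.
have [G [[GAB inj disj ind] Gmax]] :=
  Zorn_bigcup (fun F => @exchange_graph_bigcup A B F iA).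
have Gdom a : A a -> exists b, G (a, b).
  move=> Aa; apply: contrapT => na.
  have adom : ~ (fst @` G) a.
    by move=> [[a' b] Gab /= aa]; apply: na; exists b; rewrite -aa.
  have [b Gb] := exchange_graph_extend AB (And4 GAB inj disj ind) Aa adom.
  apply: (Gmax _ _ Gb); split; first exact: subsetUr.
  by move=> /(_ (a, b)) GG; apply: na; exists b; apply: GG; left.
have /choice[g gG] : forall a, exists b, A a -> G (a, b).
  move=> a; have [/Gdom[b Gb]|nAa] := pselect (A a); first by exists b.
  by exists 0.
have ginj : {in A &, injective g}.
  move=> a a' /set_mem Aa /set_mem Aa' gg; apply/eqP.
  by have /= -> := inj _ _ (gG _ Aa) (gG _ Aa'); apply/eqP.
have := inj_card_eq ginj; rewrite card_eq_le => /andP[_ /card_le_trans]; apply.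
by apply: subset_card_le => _ [a Aa <-]; have [] := GAB _ (gG _ Aa).
Qed.

Lemma hamel_basis_card W A B :
  hamel_basis W A -> hamel_basis W B -> (A #= B)%card.
Proof.
move=> [iA sA] [iB sB]; rewrite card_eq_le !lin_indep_card_le//.
- by rewrite sA -sB => v; exact: lin_span_mem.
- by rewrite sB -sA => v; exact: lin_span_mem.
Qed.

End LinearSpan.

(** * Rank-nullity for preimages of subspaces *)

Section RankNullity.
Variables (K : fieldType) (V : lmodType K).

(** Applying [L] to a relation kills the part in [C] and shows that the
    coefficients on the lifted vectors vanish; the independence of [C] settles
    the others.  Conversely a vector of [W] differs from a lift of its image by
    an element of the kernel. *)
Lemma hamel_basis_lift (V' : lmodType K) (L : {linear V -> V'})
    (W : set V) (C : set V) (D : set V') (s : V' -> V) :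
  lin_span W `<=` W -> ker L `<=` W -> hamel_basis (ker L) C ->
  hamel_basis (L @` W) D -> (forall d, D d -> W (s d) /\ L (s d) = d) ->
  hamel_basis W (s @` D `|` C).
Proof.
move=> Wspan kerW [iC sC] [iD sD] sP.
have Cker c : C c -> L c = 0.
  by move=> Cc; have : ker L c by rewrite -sC; exact: lin_span_mem.
have sDW v : (s @` D) v -> D (L v) /\ s (L v) = v.
  by move=> [d Dd <-]; have [_ ->] := sP d Dd.
split.
  move=> t a ut tDC sum0.
  pose r := [seq v <- t | v \in s @` D].
  pose q := [seq v <- t | v \notin s @` D].
  have rD u : u \in r -> (s @` D) u by rewrite mem_filter => /andP[/set_mem].
  have qC u : u \in q -> C u.
    rewrite mem_filter => /andP[/negP nD /tDC[/mem_set//|//]].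
  have split0 : \sum_(v <- r) a v *: v + \sum_(v <- q) a v *: v = 0.
    by rewrite !big_filter -[RHS]sum0 [RHS](bigID (mem (s @` D))).
  have sumr : \sum_(v <- r) a v *: L v = 0.
    have := congr1 L split0; rewrite linear0 linearD !linear_sum /=.
    rewrite [X in _ + X]big_seq [X in _ + X]big1 ?addr0 => [sumL|u /qC Cu].
      by rewrite -[RHS]sumL; apply: eq_bigr => u _; rewrite linearZ.
    by rewrite linearZ/= Cker// scaler0.
  have ar v : v \in r -> a v = 0.
    move=> vr; have [_ <-] := sDW v (rD _ vr).
    apply: (iD (map L r) (a \o s)) => /=.
    - rewrite map_inj_in_uniq ?filter_uniq// => u w.
      move=> /rD/sDW[Du <-] /rD/sDW[Dw <-].
      by rewrite (sP _ Du).2 (sP _ Dw).2 => ->.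
    - by move=> _ /mapP[u /rD/sDW[Du _] ->].
    - rewrite big_map -[RHS]sumr !big_seq; apply: eq_bigr => u /rD/sDW[_] /=.
      by move=> ->.
    - exact: map_f.
  move=> v vt; have [vD|vD] := boolP (v \in s @` D).
    by apply: ar; rewrite mem_filter vD.
  have vq : v \in q by rewrite mem_filter vD.
  apply: (iC q a _ qC) => //; first exact: filter_uniq.
  rewrite -[RHS]split0 [X in X + _]big_seq [X in X + _]big1 ?add0r// => u.
  by move=> /ar ->; rewrite scale0r.
apply/seteqP; split=> [|w Ww].
  apply: subset_trans Wspan; apply: lin_span_trans => v [[d Dd <-]|Cv].
    by apply: lin_span_mem; have [] := sP _ Dd.
  by apply/lin_span_mem/kerW/Cker.
have [t [a [tD LwE]]] : lin_span D (L w) by rewrite sD; exists w.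
pose w' := \sum_(d <- t) a d *: s d.
rewrite -(subrK w' w); apply: lin_spanD; last first.
  by apply: lin_span_sum => d /tD Dd; apply: lin_span_mem; left; exists d.
have : ker L (w - w').
  rewrite /ker/= linearB linear_sum LwE big_seq [X in _ - X]big_seq -sumrB.
  rewrite big1// => d /tD/sP[_ sd].
  by rewrite linearZ/= sd subrr.
rewrite -sC; apply: lin_span_trans => v Cv; apply: lin_span_mem; by right.
Qed.

(** Applying [c] to a relation between vectors of [c @` B] gives one between
    vectors of [B], with coefficients changed by [sigma]. *)
Lemma hamel_basis_semilinear (sigma : K -> K) (c : {additive V -> V})
    (W B : set V) :
  involutive sigma -> sigma 0 = 0 -> involutive c ->
  (forall a v, c (a *: v) = sigma a *: c v) ->
  hamel_basis W B -> hamel_basis (c @` W) (c @` B).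
Proof.
move=> sigmaK sigma0 cK cZ [iB <-].
have cB v : (c @` B) v -> B (c v) by move=> [u Bu <-]; rewrite cK.
split.
  move=> s a us sB sum0 v vs.
  rewrite -[a v]sigmaK; suff -> : sigma (a v) = 0 by [].
  rewrite -[v]cK; apply: (iB (map c s) (sigma \o a \o c)).
  - by rewrite map_inj_uniq//; exact: can_inj cK.
  - by move=> _ /mapP[u /sB/cB Bu ->].
  - have := congr1 c sum0; rewrite raddf0 raddf_sum big_map => sumc.
    by rewrite -[RHS]sumc; apply: eq_bigr => u _; rewrite cZ /= cK.
  - exact: map_f.
apply/seteqP; split.
  move=> _ [s [a [sB ->]]].
  exists (c (\sum_(u <- s) a u *: u)); last by rewrite cK.
  rewrite raddf_sum; under eq_bigr do rewrite cZ.
  apply: (lin_span_sum (sigma \o a)) => u /sB/cB; exact: lin_span_mem.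
move=> _ [_ [s [a [sB ->]]] <-].
rewrite raddf_sum; under eq_bigr do rewrite cZ.
apply: (lin_span_sum (sigma \o a)) => u /sB Bu.
by apply: lin_span_mem; exists u.
Qed.

(** The kernel enters through a semilinear copy [W2] because the orthogonal
    complement of a range is only the conjugate of a kernel. *)
Lemma dim_eq_add_preimage (L : {linear V -> V}) (sigma : K -> K)
    (c : {additive V -> V}) (N W2 : set V) :
  involutive sigma -> sigma 0 = 0 -> involutive c ->
  (forall a v, c (a *: v) = sigma a *: c v) ->
  c @` W2 = ker L ->
  dim_eq_add (L @^-1` N) (range L `&` N) W2.
Proof.
move=> sigmaK sigma0 cK cZ cW2 B B1 B2; set W := L @^-1` N => BW.
have -> : range L `&` N = L @` W.
  apply/seteqP; split=> [_ [[w _ <-] Nw]|_ [w Nw <-]]; first by exists w.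
  by split=> //; exists w.
move=> B1W B2W.
(* [W] is the span of its basis, hence a subspace, whatever the set [N] is. *)
have Wspan : lin_span W `<=` W.
  by case: BW => _ <-; exact: lin_span_trans.
have W0 : W 0 by apply: Wspan; exact: lin_span0.
have kerW : ker L `<=` W.
  by move=> v; rewrite /ker/= /W/= => ->; rewrite -(linear0 L).
have bC : hamel_basis (ker L) (c @` B2).
  by rewrite -cW2; exact: (hamel_basis_semilinear sigmaK).
have /choice[s sP] : forall d, exists w, B1 d -> W w /\ L w = d.
  move=> d; have [B1d|nB1d] := pselect (B1 d); last by exists 0.
  have : (L @` W) d by case: B1W => _ <-; exact: lin_span_mem.
  by move=> [w Ww <-]; exists w.
have bW := hamel_basis_lift Wspan kerW bC B1W sP.
apply: card_eq_trans (hamel_basis_card BW bW) _.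
pose h (x : V + V) := match x with inl v => s v | inr v => c v end.
pose D : set (V + V) := [set inl b | b in B1] `|` [set inr b | b in B2].
have hD : h @` D = s @` B1 `|` c @` B2.
  by rewrite image_setU !image_comp.
rewrite -hD; apply: inj_card_eq.
have nsc b b' : B1 b -> B2 b' -> s b <> c b'.
  move=> Bb Bb' sc; have [_ sb] := sP _ Bb.
  have : ker L (c b') by case: bC => _ <-; apply: lin_span_mem; exists b'.
  rewrite /ker/= -sc sb => b0.
  by have := lin_indep_neq0 B1W.1 Bb; rewrite b0 eqxx.
move=> _ _ /set_mem[[b Bb <-]|[b Bb <-]] /set_mem[[b' Bb' <-]|[b' Bb' <-]] /= e.
- by have [_ <-] := sP _ Bb; have [_ <-] := sP _ Bb'; rewrite e.
- by case: (nsc b b').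
- by case: (nsc b' b).
- by rewrite (can_inj cK e).
Qed.

End RankNullity.

(** * Modulus and conjugation of scalars *)

Section Scalars.
Context {R : realType} {k : scalar_kind}.
Local Notation K := (scalar_field R k).
Implicit Types (z l : K) (u : nat -> K).

Lemma smodN z : smod (- z) = smod z.
Proof. by case: k z => z /=; [exact: normrN|exact: normcN]. Qed.

Lemma smod_sconj z : smod (sconj z) = smod z.
Proof. by case: k z => // -[a b] /=; rewrite sqrrN. Qed.

Lemma sconjK : involutive (@sconj R k).
Proof. by case: k => // z /=; exact: conjcK. Qed.

Lemma sconj0 : @sconj R k 0 = 0.
Proof. by case: k => //=; exact: conjc0. Qed.

Lemma sconjB : {morph @sconj R k : x y / x - y}.
Proof. by case: k => // x y /=; exact: raddfB. Qed.

Lemma sconjM : {morph @sconj R k : x y / x * y}.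
Proof. by case: k => // x y /=; exact: rmorphM. Qed.

Lemma norm_smod (z : scalar_field R ComplexScalars) : `|z| = ((smod z)%:C)%C.
Proof. by rewrite normc_def; case: z. Qed.

(** The topology of the scalars is given by their norm, which is a complex
    number when they are complex; this restates convergence through the
    real-valued modulus, uniformly in the two cases. *)
Lemma smod_cvg u l :
  u @ \oo --> l <->
  forall e : R, 0 < e -> \forall n \near \oo, smod (l - u n) < e.
Proof.
split.
  case: k u l => u l /cvgrPdist_lt /= ul e e0; first exact: ul.
  have := ul (e%:C)%C; rewrite ltcR => /(_ e0).
  by apply: filterS => n; rewrite norm_smod ltcR.
case: k u l => u l ul; apply/cvgrPdist_lt => e e0; first exact: ul.
have [d d0 ->] : exists2 d : R, 0 < d & e = (d%:C)%C.
  case: e e0 => a b; rewrite ltcE/= => /andP[/eqP -> a0]; by exists a.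
have := ul _ d0.
by apply: filterS => n; rewrite norm_smod ltcR.
Qed.

Lemma smod_squeeze_cvg u l (v : nat -> R) :
  (forall n, smod (l - u n) <= v n) -> v @ \oo --> 0 -> u @ \oo --> l.
Proof.
move=> uv /cvgrPdist_lt v0; apply/smod_cvg => e /v0.
apply: filterS => n; rewrite sub0r normrN; apply: le_lt_trans.
by apply: le_trans (uv n) _; exact: ler_norm.
Qed.

Lemma smod_lim_le u l (c : R) :
  u @ \oo --> l -> (forall n, smod (u n) <= c) -> smod l <= c.
Proof.
move=> /smod_cvg ul uc; apply/ler_addgt0Pr => e /ul [N _ /(_ N (leqnn N)) uN].
rewrite -[l](subrK (u N)) addrC (le_trans (smodD _ _))//.
by rewrite lerD// ltW.
Qed.

End Scalars.

(** With [A], [B] the sums of squares and [S] the mixed sum, the sum of the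
    squares of [A * b i - S * a i] equals [A * (A * B - S ^+ 2)]. *)
Lemma sum_cauchy_schwarz (R : realType) (a b : nat -> R) n :
  (\sum_(i < n) a i * b i) ^+ 2 <=
  (\sum_(i < n) a i ^+ 2) * (\sum_(i < n) b i ^+ 2).
Proof.
set A := \sum_(i < n) a i ^+ 2; set B := \sum_(i < n) b i ^+ 2.
set S := \sum_(i < n) a i * b i.
have A0 : 0 <= A by apply: sumr_ge0 => i _; exact: sqr_ge0.
have B0 : 0 <= B by apply: sumr_ge0 => i _; exact: sqr_ge0.
have : 0 <= \sum_(i < n) (A * b i - S * a i) ^+ 2.
  by apply: sumr_ge0 => i _; exact: sqr_ge0.
have -> : \sum_(i < n) (A * b i - S * a i) ^+ 2 = A * (A * B - S ^+ 2).
  transitivity (\sum_(i < n) (A ^+ 2 * b i ^+ 2 - (A * S *+ 2) * (a i * b i)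
      + S ^+ 2 * a i ^+ 2)); first by apply: eq_bigr => i _; ring.
  rewrite big_split sumrB -!mulr_sumr/= -/A -/B -/S.
  by ring.
have [A00 _|A00] := eqVneq A 0; last by rewrite pmulr_rge0 ?subr_ge0// lt0r A00.
suff -> : S = 0 by rewrite expr0n mulr_ge0.
rewrite /S big1// => i _; have /eqP := A00.
rewrite psumr_eq0 => [/allP/(_ i (mem_index_enum _))/=|j _].
  by rewrite sqrf_eq0 => /eqP ->; rewrite mul0r.
exact: sqr_ge0.
Qed.

(** * Square-summable sequences and the transpose *)

Section SquareSummable.
Context {R : realType} {k : scalar_kind}.
Local Notation K := (scalar_field R k).
Local Notation l2 := (l2 R k).
Implicit Types x y w : l2.

Lemma sqsum_ge0 (x : nat -> K) : (0 <= sqsum x)%E.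
Proof. by apply: nneseries_ge0 => i _ _; rewrite lee_fin sqr_ge0. Qed.

Lemma sqsum_fin x : sqsum x \is a fin_num.
Proof.
rewrite ge0_fin_numE ?sqsum_ge0//; exact/asboolP/(l2seqP x).
Qed.

Lemma l2norm_ge0 x : 0 <= l2norm x. Proof. exact: sqrtr_ge0. Qed.

Lemma sqr_l2norm x : l2norm x ^+ 2 = fine (sqsum x).
Proof. by rewrite sqr_sqrtr// fine_ge0// sqsum_ge0. Qed.

Lemma sum_smod_le_l2norm x n : \sum_(i < n) smod (x i) ^+ 2 <= l2norm x ^+ 2.
Proof.
rewrite sqr_l2norm -lee_fin fineK ?sqsum_fin// -sumEFin.
rewrite -(big_mkord xpredT (fun i => (smod (x i) ^+ 2)%:E)).
by apply: nneseries_lim_ge => i _ _; rewrite lee_fin sqr_ge0.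
Qed.

Lemma smod_le_l2norm x i : smod (x i) <= l2norm x.
Proof.
rewrite -(@ler_pXn2r _ 2)// ?nnegrE ?smod_ge0 ?l2norm_ge0//.
apply: le_trans (sum_smod_le_l2norm x i.+1); rewrite big_ord_recr/=.
by rewrite lerDr sumr_ge0// => j _; exact: sqr_ge0.
Qed.

Lemma l2normN x : l2norm (- x) = l2norm x.
Proof.
rewrite /l2norm /sqsum; congr (Num.sqrt (fine _)); apply: eq_eseriesr => i _.
by rewrite -(smodN (x i)).
Qed.

Lemma smod_pairing_le x y n :
  smod (\sum_(i < n) (x i : K) * y i) <= l2norm x * l2norm y.
Proof.
apply: (@le_trans _ _ (\sum_(i < n) smod (x i) * smod (y i))).
  elim/big_ind2: _ => [|a b c d ab cd|i _]; first by rewrite smod0.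
    by rewrite (le_trans (smodD _ _))// lerD.
  by rewrite smodM.
rewrite -(@ler_pXn2r _ 2)// ?nnegrE ?mulr_ge0 ?l2norm_ge0//; last first.
  by apply: sumr_ge0 => i _; rewrite mulr_ge0 ?smod_ge0.
apply: le_trans.
  exact: (sum_cauchy_schwarz (fun i => smod (x i)) (fun i => smod (y i))).
rewrite exprMn; apply: ler_pM; rewrite ?sum_smod_le_l2norm//.
  by apply: sumr_ge0 => i _; exact: sqr_ge0.
by apply: sumr_ge0 => i _; exact: sqr_ge0.
Qed.

Definition l2_trunc x n : l2 := \sum_(j < n) (x j : K) *: l2_delta R k j.

Lemma l2_sumE (I : Type) (r : seq I) (F : I -> l2) i :
  (\sum_(j <- r) F j) i = \sum_(j <- r) F j i.
Proof. by apply: (big_morph (fun x : l2 => x i)). Qed.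

Lemma l2_truncE x n i : l2_trunc x n i = if (i < n)%N then x i else 0.
Proof.
rewrite l2_sumE; transitivity (\sum_(j < n | i == j :> nat) (x j : K)).
  rewrite [RHS]big_mkcond/=; apply: eq_bigr => j _.
  rewrite [LHS](_ : _ = (x j : K) * (i == j)%:R)//.
  by case: eqP; rewrite ?mulr1 ?mulr0.
case: ltnP => [ilt|ni].
  by rewrite (big_pred1 (Ordinal ilt)).
by rewrite big1// => j /eqP ij; move: ni; rewrite ij leqNgt ltn_ord.
Qed.

Lemma l2_trunc_cvg x : l2norm (x - l2_trunc x n) @[n --> \oo] --> (0 : R).
Proof.
have tail n : sqsum (x - l2_trunc x n) =
    (\sum_(n <= i <oo) (smod (x i) ^+ 2)%:E)%E.
  rewrite /sqsum (nneseries_split 0 n) => [|i _]; last first.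
    by rewrite lee_fin sqr_ge0.
  have crd i : (x - l2_trunc x n) i = (x i : K) - (l2_trunc x n i) by [].
  rewrite add0n big_nat big1 ?add0e => [|i /andP[_ ilt]].
    apply/congr_lim/funext => m; apply: eq_big_nat => i /andP[ni _].
    by rewrite crd l2_truncE ltnNge ni subr0.
  by rewrite crd l2_truncE ilt subrr smod0 expr0n.
rewrite -[X in _ --> X]sqrtr0; apply: continuous_cvg.
  exact: sqrt_continuous.
apply: fine_cvg; under eq_cvg do rewrite tail.
apply: nneseries_tail_cvg => [|i _]; last by rewrite lee_fin sqr_ge0.
exact/asboolP/(l2seqP x).
Qed.

(** [U] is continuous, the truncations of [x] converge to [x] in norm, and the
    coordinate [i] of [U (l2_trunc x n)] is a partial sum of the series. *)
Lemma l2_matrix_cvg (U : {linear l2 -> l2}) x i : l2_bounded U ->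
  series (fun j => l2_matrix U i j * x j) @ \oo --> (U x i : K).
Proof.
move=> [M UM].
apply: (smod_squeeze_cvg (v := fun n => M * l2norm (x - l2_trunc x n))).
  move=> n; apply: le_trans (UM _).
  have -> : (U x i : K) - series (fun j => l2_matrix U i j * x j) n =
      U (x - l2_trunc x n) i.
    have -> : series (fun j => l2_matrix U i j * x j) n = U (l2_trunc x n) i.
      rewrite linear_sum l2_sumE seriesEord; apply: eq_bigr => j _.
      by rewrite linearZ; exact: mulrC.
    by rewrite linearB.
  exact: smod_le_l2norm.
by rewrite -(mulr0 M); apply: cvgMr; exact: l2_trunc_cvg.
Qed.

(** The bilinear pairing of [U x] with [w] vanishes when [UT w = 0].  The
    [m]-th partial sum is the pairing of [U x] with [w_m := l2_trunc w m]; since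
    [w_m] is finitely supported, expanding [U x] by its matrix shows that it is
    also the pairing of [x] with [UT w_m].  The latter is at most the product of
    the norms of [x] and [UT w_m = - UT (w - w_m)], which tends to 0. *)
Lemma pairing_transpose_cvg0 (U UT : {linear l2 -> l2}) x w :
  l2_bounded U -> l2_bounded UT ->
  (forall i j, l2_matrix UT i j = l2_matrix U j i) -> UT w = 0 ->
  series (fun i => (U x i : K) * w i) @ \oo --> (0 : K).
Proof.
move=> Ub UTb UTU UTw; have [M UTM] := UTb.
apply: (smod_squeeze_cvg
    (v := fun m => l2norm x * (M * l2norm (w - l2_trunc w m)))); last first.
  rewrite -(mulr0 (l2norm x)) -(mulr0 M).
  by do 2 apply: cvgMr; exact: l2_trunc_cvg.
move=> m; rewrite sub0r smodN.
pose wm := l2_trunc w m.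
apply: (@smod_lim_le _ _ (fun n => \sum_(j < n) (x j : K) * UT wm j)) => [|n].
  rewrite seriesEord/=.
  have -> : (fun n => \sum_(j < n) (x j : K) * UT wm j) =
     (fun n => \sum_(i < m) series (fun j => l2_matrix U i j * x j) n * w i).
    apply/funext => n; under [RHS]eq_bigr do rewrite seriesEord mulr_suml.
    rewrite exchange_big/=; apply: eq_bigr => j _.
    rewrite linear_sum l2_sumE mulr_sumr; apply: eq_bigr => i _.
    rewrite linearZ/= -UTU [X in _ * X](_ : _ = (w i : K) * l2_matrix UT j i)//.
    by ring.
  apply: cvg_big => [|i _]; first exact: add_continuous.
  by apply: cvgMl; exact: l2_matrix_cvg.
apply: (le_trans (smod_pairing_le _ _ _)).
rewrite ler_wpM2l ?l2norm_ge0//; apply: le_trans (UTM _).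
by rewrite linearB UTw sub0r l2normN.
Qed.

Fact l2_conj_subproof x :
  (fun i => sconj (x i) : K^o) \in @l2_pred R k.
Proof.
apply/asboolP; have /asboolP := l2seqP x; rewrite /sqsum.
by under [X in _ -> (X < _)%E]eq_eseriesr do rewrite smod_sconj.
Qed.

Definition l2_conj x : l2 := L2 (l2_conj_subproof x).

Lemma l2_eqP x y : (forall i, x i = y i) -> x = y.
Proof. by move=> xy; apply: val_inj; apply/funext. Qed.

Lemma l2_conjK : involutive l2_conj.
Proof. by move=> x; apply: l2_eqP => i; exact: sconjK. Qed.

Lemma l2_conjZ (a : K) x : l2_conj (a *: x) = sconj a *: l2_conj x.
Proof. by apply: l2_eqP => i; exact: sconjM. Qed.

Fact l2_conj_is_zmod_morphism : {morph l2_conj : x y / x - y}.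
Proof.
move=> x y; apply: l2_eqP => i.
transitivity (sconj ((x i : K) - y i)) => //; exact: sconjB.
Qed.

HB.instance Definition _ :=
  GRing.isZmodMorphism.Build l2 l2 l2_conj l2_conj_is_zmod_morphism.

(** One inclusion tests orthogonality on the columns [U (l2_delta j)] only:
    their inner products with [y] are the coordinates of [UT (l2_conj y)].  The
    other is [pairing_transpose_cvg0]. *)
Lemma l2_conj_orthogonal_range (U UT : {linear l2 -> l2}) :
  l2_bounded U -> l2_bounded UT ->
  (forall i j, l2_matrix UT i j = l2_matrix U j i) ->
  l2_conj @` l2_orthogonal (range U) = ker UT.
Proof.
move=> Ub UTb UTU; apply/seteqP; split=> [_ [y yU <-]|w UTw].
  apply: l2_eqP => j.
  rewrite -(cvg_lim _ (l2_matrix_cvg (x := l2_conj y) (i := j) UTb))//.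
  under eq_fun do rewrite UTU.
  exact: (yU _ (imageT U (l2_delta R k j))).
exists (l2_conj w); last exact: l2_conjK.
move=> _ [x _ <-]; apply: cvg_lim => //.
rewrite (_ : (fun i => _) = fun i => (U x i : K) * w i).
  exact: pairing_transpose_cvg0 UTw.
by apply/funext => i; congr (_ * _); exact: sconjK.
Qed.

End SquareSummable.

Theorem theorem2 (R : realType) (k : scalar_kind)
  (H : completeNormedModType (scalar_field R k)) (ip : {dot H for @sconj R k})
  (ip_norm : forall x : H, `|x| ^+ 2 = ip x x)
  (H_separable : separable H)
  (f : nat -> H) (f_frame : is_frame ip f)
  (U UT : {linear l2 R k -> l2 R k})
  (U_bounded : l2_bounded U) (UT_bounded : l2_bounded UT)
  (UT_transpose : forall i j : nat, l2_matrix UT i j = l2_matrix U j i) :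
  dim_eq_add (ker (preframe f \o UT))
             (range UT `&` ker (preframe f))
             (l2_orthogonal (range U)).
Proof.
apply: (@dim_eq_add_preimage _ _ UT _ (@l2_conj R k) (ker (preframe f)) _
  sconjK sconj0 l2_conjK l2_conjZ).
exact: l2_conj_orthogonal_range.
Qed.
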